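(* Let $\frac12\le H_1<H_2<1$ and $T>0$, and let $\kappa$ be the kernel defined in the context. For $s,u\in(0,T]$, $s\neq u$, put $$\varphi(s,u)=(s\wedge u)^{1-2H_1}u^{2H_1-1}|s-u|^{2H_2-2H_1-1}.$$ Then there exists a bounded function $\kappa_0:[0,T]^2\to\mathbb{R}$ that is continuous on $[0,T]^2\setminus\{(0,0)\}$ such that, up to a set of $(s,u)\in[0,T]^2$ of Lebesgue measure zero, $$\kappa(s,u)=\begin{cases}\kappa_0(s,u)\,\varphi(s,u), & s\ne u,\\ 0,& s=u.\end{cases}$$
   Context: $\mathrm{B}(\alpha,\beta)=\int_0^1x^{\alpha-1}(1-x)^{\beta-1}dx$ is the beta function, and $\beta_H=\left(\frac{H(2H-1)}{\mathrm{B}(H-1/2,\,2-2H)}\right)^{1/2}$. For $0<s<t$ put $$K_{H_1,H_2}(t,s)=\beta_{H_2}s^{1/2-H_2}\int_s^t(t-u)^{1/2-H_1}u^{H_2-H_1}(u-s)^{H_2-3/2}\,du .$$ For $s,u>0$, $s\ne u$, put $$k(s,u)=\int_0^{s\wedge u}\partial_sK_{H_1,H_2}(s,v)\,\partial_uK_{H_1,H_2}(u,v)\,dv,$$ where $\partial_s K_{H_1,H_2}(s,v)$ and $\partial_u K_{H_1,H_2}(u,v)$ denote derivatives with respect to the first argument of $K_{H_1,H_2}$, and $s\wedge u=\min(s,u)$. Put $$\kappa(s,u)=u^{2H_1-1}k(s,u).$$ *)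

(* Defs.v *)
From HB Require Import structures.
From mathcomp Require Import all_boot all_order all_algebra.
From mathcomp Require Import all_classical all_reals all_analysis.

Set Implicit Arguments.
Unset Strict Implicit.
Unset Printing Implicit Defensive.

Import Order.TTheory GRing.Theory Num.Theory.
Import numFieldNormedType.Exports.

Local Open Scope classical_set_scope.
Local Open Scope ring_scope.

(* All integrals below are Lebesgue integrals over open intervals, so that the
   integrands, which may be singular at the endpoints, are only evaluated where
   every base of a power is positive: [powR] (written [`^]) is the usual real
   power for positive bases, with conventional values elsewhere. *)

(* The library's [beta_fun] only takes natural number arguments. *)
Definition Beta {R : realType} (a b : R) : R :=
  \int[lebesgue_measure]_(x in `]0, 1[) (x `^ (a - 1) * (1 - x) `^ (b - 1)).

Definition beta_const {R : realType} (H : R) : R :=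
  (H * (2 * H - 1) / Beta (H - 1 / 2) (2 - 2 * H)) `^ (1 / 2).

(* Intended for 0 < s < t. *)
Definition K {R : realType} (H1 H2 t s : R) : R :=
  beta_const H2 * s `^ (1 / 2 - H2) *
  \int[lebesgue_measure]_(u in `]s, t[)
    ((t - u) `^ (1 / 2 - H1) * u `^ (H2 - H1) * (u - s) `^ (H2 - 3 / 2)).

Definition dK {R : realType} (H1 H2 t s : R) : R :=
  derive1 (fun x : R => K H1 H2 x s : R^o) t.

(* Intended, like [kappa], for s, u > 0 and s != u. *)
Definition k {R : realType} (H1 H2 s u : R) : R :=
  \int[lebesgue_measure]_(v in `]0, Num.min s u[)
    (dK H1 H2 s v * dK H1 H2 u v).

Definition kappa {R : realType} (H1 H2 s u : R) : R :=
  u `^ (2 * H1 - 1) * k H1 H2 s u.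

Definition phi {R : realType} (H1 H2 s u : R) : R :=
  Num.min s u `^ (1 - 2 * H1) * u `^ (2 * H1 - 1) *
  `|s - u| `^ (2 * H2 - 2 * H1 - 1).

Definition square {R : realType} (T : R) : set (R * R) :=
  `[0, T] `*` `[0, T].

(* Main.v *)
(* Write a = H1 - 1/2, b = H2 - 1/2, so that 0 <= a < b < 1/2.  Substituting
   w = t - (t - s) y in the integral defining K moves the singularities to the
   fixed weight y^(-a) (1 - y)^(b - 1) on ]0, 1[, so that one can differentiate
   under the integral sign; by homogeneity
     dK(t, s) = beta (b - a) s^(-b) (t - s)^(b - a - 1) t^(b - a) g(s / t)
   with g bounded and continuous on [0, 1].  For s < u and x = s / u, the Moebius
   substitution v = s (1 - y) / (1 - x y) in the integral defining k(s, u) has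
   s - v = x y (u - s) / (1 - x y) and u - v = (u - s) / (1 - x y), which extracts
   the whole factor (u - s)^(2 (b - a) - 1) and leaves
     int_0^1 y^(b - a - 1) (1 - y)^(-2 b) (1 - x y)^(2 a) g(z) g(x z) dy,
     z = (1 - y) / (1 - x y).
   As a >= 0, its integrand is dominated uniformly in x in [0, 1], so this is a
   continuous function of x up to and including x = 1 (the diagonal), and kappa0
   is this function of min(s, u) / max(s, u). *)

Require Import Defs.
From HB Require Import structures.
From mathcomp Require Import all_boot all_order all_algebra.
From mathcomp Require Import all_classical all_reals all_analysis.
From mathcomp Require Import measurable_realfun ring lra.

Set Implicit Arguments.
Unset Strict Implicit.
Unset Printing Implicit Defensive.

Import Order.TTheory GRing.Theory Num.Theory.
Import numFieldNormedType.Exports.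

Local Open Scope classical_set_scope.
Local Open Scope ring_scope.

(** * Decreasing changes of variables on open intervals *)

(** The rule on compact intervals, applied to [[a + e n, b - e n]], passes to the limit by monotone
    convergence, so [f] and [G] may blow up at the endpoints. As [G] is nonnegative, the identity
    lives in the extended reals and carries no integrability condition. *)
Lemma ge0_integration_by_substitution_decreasing_oo (R : realType)
    (F f G : R -> R) (a b : R) : a < b ->
  {within `[a, b], continuous F} ->
  {in `]a, b[, forall x : R, is_derive x (1 : R) F (f x)} ->
  {in `]a, b[, forall x, f x < 0} ->
  {in `]a, b[, continuous f} ->
  {in `]F b, F a[, continuous G} ->
  {in `]F b, F a[, forall x, 0 <= G x} ->
  (\int[lebesgue_measure]_(x in `]F b, F a[) (G x)%:E =
   \int[lebesgue_measure]_(x in `]a, b[) (G (F x) * - f x)%:E)%E.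
Proof.
move=> ab cF dF f_lt0 cf cG G_ge0.
have F_decr : {in `[a, b] &, {homo F : x y /~ x < y}}.
  move=> y x; rewrite !in_itv/= => /andP[ay yb] /andP[ax xb] xy.
  have sub z : z \in `]x, y[ -> z \in `]a, b[.
    by rewrite !in_itv/= => /andP[xz zy]; lra.
  have [||c xcy] := @MVT _ F f _ _ xy.
  - by move=> z /sub; exact: dF.
  - apply: continuous_subspaceW cF => z /=.
    by rewrite !in_itv/= => /andP[xz zy]; lra.
  - move=> E; rewrite -subr_lt0 E nmulr_rlt0 ?subr_gt0//.
    exact/f_lt0/sub.
have F_ninc x y : x \in `[a, b] -> y \in `[a, b] -> x <= y -> F y <= F x.
  move=> xab yab; rewrite le_eqVlt => /predU1P[->//|xy].
  exact/ltW/F_decr.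
(* The denominator [n.+3] gives [2 * e n < b - a] already for [n = 0], so no compact interval is
   degenerate. *)
pose e n : R := (b - a) / n.+3%:R.
have e_gt0 n : 0 < e n by rewrite divr_gt0 ?subr_gt0 ?ltr0n.
have e_lt n : e n + e n < b - a.
  rewrite /e -mulrDl ltr_pdivrMr ?ltr0n//.
  have : 3 <= n.+3%:R :> R by rewrite ler_nat.
  by move: ab; rewrite -subr_gt0; nra.
have e_ninc m n : (m <= n)%N -> e n <= e m.
  move=> mn; rewrite ler_pM2l ?subr_gt0// lef_pV2 ?posrE ?ltr0n// ler_nat.
  by rewrite !ltnS.
have e_small r : 0 < r -> exists n, e n <= r.
  move=> r0; have d0 : 0 < r / (b - a) by rewrite divr_gt0 ?subr_gt0.
  have [N _ /(_ _ (leqnn N)) /= HN] := near_infty_natSinv_lt (PosNum d0).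
  exists N; rewrite /e mulrC -ler_pdivlMr ?subr_gt0//.
  apply: le_trans (ltW HN); rewrite lef_pV2 ?posrE ?ltr0n// ler_nat.
  exact: leqW.
pose an n := a + e n; pose bn n := b - e n.
have anbn n : [/\ a < an n, an n < bn n & bn n < b].
  by have := e_gt0 n; have := e_lt n; rewrite /an /bn; split; lra.
have an_ab n : an n \in `[a, b] by rewrite in_itv/=; have [] := anbn n; lra.
have bn_ab n : bn n \in `[a, b] by rewrite in_itv/=; have [] := anbn n; lra.
have sub_anbn n x : x \in `[an n, bn n] -> x \in `]a, b[.
  by rewrite !in_itv/=; have [] := anbn n; lra.
have exh x : x \in `]a, b[ -> exists n, x \in `[an n, bn n].
  rewrite in_itv/= => /andP[ax xb].
  have [|n en] := e_small (Num.min (x - a) (b - x)).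
    by rewrite lt_min !subr_gt0 ax.
  exists n; move: en; rewrite le_min in_itv/= /an /bn => /andP[]; lra.
have aab : a \in `[a, b] by rewrite in_itv/= lexx ltW.
have bab : b \in `[a, b] by rewrite in_itv/= lexx ltW.
have subF n x : x \in `[F (bn n), F (an n)] -> x \in `]F b, F a[.
  rewrite !in_itv/= => /andP[h1 h2]; have [h3 h4 h5] := anbn n.
  by rewrite (lt_le_trans _ h1) ?(le_lt_trans h2)// F_decr.
have e1 : `]a, b[%classic = \bigcup_n `[an n, bn n]%classic :> set R.
  apply/seteqP; split => x /=; first by move=> /exh[n xn]; exists n.
  by move=> [n _ /=]; exact: sub_anbn.
(* A value strictly between [F b] and [F a] is some [F c] by the intermediate value theorem; [c] is
   not an endpoint, so it lies in one of the compact intervals. *)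
have e2 : `]F b, F a[%classic = \bigcup_n `[F (bn n), F (an n)]%classic :> set R.
  apply/seteqP; split => z /=; last by move=> [n _ /=]; exact: subF.
  rewrite in_itv/= => /andP[bz za].
  have FbFa : F b <= F a by rewrite (le_trans (ltW bz)) ?(ltW za).
  have [|c] := @IVT _ F _ _ z (ltW ab) cF.
    by rewrite (min_idPr FbFa) (max_idPl FbFa) (ltW bz) (ltW za).
  rewrite in_itv/= => /andP[ac cb] Fcz.
  have cab : c \in `]a, b[.
    rewrite in_itv/= !lt_neqAle ac cb !andbT; apply/andP; split.
      by apply/eqP => ca; move: za; rewrite -Fcz -ca ltxx.
    by apply/eqP => ca; move: bz; rewrite -Fcz -ca ltxx.
  have [n] := exh _ cab; rewrite in_itv/= => /andP[h1 h2].
  exists n => //=; rewrite in_itv/= -Fcz !F_ninc// in_itv/= ac cb//.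
have dFE : {in `]a, b[, derive1 F =1 f}.
  by move=> x xab; rewrite derive1E; have [_ ->] := dF _ xab.
have mG n : measurable_fun `[F (bn n), F (an n)] G.
  apply: (measurable_funS (E := `]F b, F a[%classic)) => //.
    by move=> x; exact: subF.
  apply: open_continuous_measurable_fun => // x.
  by rewrite inE/=; exact: cG.
have contF : {in `]a, b[, continuous F}.
  move=> x xab; apply: differentiable_continuous.
  by apply/derivable1_diffP; have [] := dF _ xab.
have FI x : x \in `]a, b[ -> F x \in `]F b, F a[.
  move=> xab; have : x \in `[a, b] by exact: subset_itv_oo_cc.
  move=> xab'; move: xab; rewrite !in_itv/= => /andP[ax xb].
  by rewrite !F_decr.
have mH n : measurable_fun `[an n, bn n] (fun x => G (F x) * - f x).
  apply: (measurable_funS (E := `]a, b[%classic)) => //.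
    by move=> x; exact: sub_anbn.
  apply: open_continuous_measurable_fun => // x.
  rewrite inE/= => xab; apply: cvgM.
    apply: (@continuous_comp _ _ _ F G); first exact: contF.
    exact/cG/FI.
  by apply: cvgN; exact: cf.
have step n : (\int[lebesgue_measure]_(x in `[F (bn n), F (an n)]) (G x)%:E =
    \int[lebesgue_measure]_(x in `[an n, bn n]) (G (F x) * - f x)%:E)%E.
  have [h1 h2 h3] := anbn n.
  (* The compact rule is phrased with [derive1 F], known to equal [f] only inside []a, b[]; its
     continuity at [x] is transferred from [f] by agreement near [x]. *)
  have cdF x : x \in `]a, b[ -> derive1 F y @[y --> x] --> derive1 F x.
    move=> xab; rewrite dFE//.
    apply: cvg_trans (cf _ xab); apply: near_eq_cvg.
    near=> y; apply/esym/dFE; near: y.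
    exact: near_in_itvoo.
  have anI : an n \in `]a, b[ by rewrite in_itv/=; lra.
  have bnI : bn n \in `]a, b[ by rewrite in_itv/=; lra.
  rewrite integration_by_substitution_decreasing.
  - apply: eq_integral => x /[!inE]/= /sub_anbn xab.
    by rewrite !fctE dFE.
  - exact: ltW.
  - by move=> x y xn yn; apply: F_decr; apply/subset_itv_oo_cc; apply: (sub_anbn n).
  - by move=> x xn; apply: cdF; exact: (sub_anbn n _ (subset_itv_oo_cc xn)).
  - apply/cvg_ex; exists (derive1 F (an n)); apply: cvg_at_right_filter.
    exact: cdF.
  - apply/cvg_ex; exists (derive1 F (bn n)); apply: cvg_at_left_filter.
    exact: cdF.
  - split.
    + move=> x xn; have [] // := dF x _.
      exact: (sub_anbn n _ (subset_itv_oo_cc xn)).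
    + by apply: cvg_at_right_filter; exact: contF.
    + by apply: cvg_at_left_filter; exact: contF.
  - apply: continuous_in_subspaceT => x /[!inE]/= xn.
    exact/cG/subF/xn.
rewrite e1 e2.
(* Each side is the limit of its integrals over the exhausting intervals, and [step] identifies the
   two sequences. *)
transitivity (limn (fun n =>
  \int[lebesgue_measure]_(x in `[F (bn n), F (an n)]) (G x)%:E)%E).
  apply/esym/cvg_lim => //.
  apply: (@ge0_nondecreasing_set_cvg_integral _ (measurableTypeR R) R
    (fun n => `[F (bn n), F (an n)]%classic) (EFin \o G) (@lebesgue_measure R)) => //.
  - move=> m n mn; apply/subsetPset => x /=; rewrite !in_itv/= => /andP[h1 h2].
    have := e_ninc _ _ mn => emn.
    by rewrite (le_trans _ h1) ?(le_trans h2)// F_ninc// /bn /an; lra.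
  - by move=> n; apply/measurable_EFinP; exact: mG.
  - by move=> n x /subF; rewrite lee_fin; exact: G_ge0.
under eq_fun do rewrite step.
apply/cvg_lim => //.
apply: (@ge0_nondecreasing_set_cvg_integral _ (measurableTypeR R) R
  (fun n => `[an n, bn n]%classic) (fun x => (G (F x) * - f x)%:E) (@lebesgue_measure R)) => //.
- move=> m n mn; apply/subsetPset => x /=; rewrite !in_itv/=.
  by have := e_ninc _ _ mn => emn; rewrite /an /bn; lra.
- by move=> n; apply/measurable_EFinP; exact: mH.
- move=> n x /sub_anbn xab; rewrite lee_fin mulr_ge0 ?G_ge0 ?FI//.
  by rewrite oppr_ge0 ltW ?f_lt0.
Unshelve. all: by end_near. Qed.

(** * Real powers and integrability of beta weights *)

Lemma continuous_powR (R : realType) (p x : R) : 0 < x ->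
  {for x, continuous (fun z : R => z `^ p)}.
Proof.
move=> x0; apply: differentiable_continuous; apply/derivable1_diffP.
by have [] := is_derive1_powR p x0.
Qed.

Lemma continuous_onem (R : realType) : continuous (fun y : R => 1 - y).
Proof. by move=> y; apply: cvgB; [exact: cvg_cst|exact: cvg_id]. Qed.

Lemma le0_ger_powR (R : realType) (r x y : R) : r <= 0 -> 0 < x -> x <= y ->
  y `^ r <= x `^ r.
Proof.
move=> r0 x0 xy; have y0 : 0 < y by exact: lt_le_trans xy.
by rewrite /powR !gt_eqF// ler_expR ler_wnM2l// ler_ln.
Qed.

Lemma powR_le1 (R : realType) (p x : R) : 0 <= p -> 0 <= x -> x <= 1 ->
  x `^ p <= 1.
Proof.
move=> p0 x0 x1.
have /(_ _ _ x1) := @ge0_ler_powR _ _ p0 x 1.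
by rewrite powR1; apply; rewrite nnegrE.
Qed.

(* Substitution of 1 - y^q in the integral of the constant 1. *)
Lemma integrable_powR01 (R : realType) (q : R) : 0 < q ->
  lebesgue_measure.-integrable `]0, 1[%classic
    (EFin \o (fun y : R => y `^ (q - 1))).
Proof.
move=> q0.
have cq : {in `]0, 1[%R, continuous (fun y : R => y `^ (q - 1))}.
  by move=> x; rewrite in_itv/= => /andP[x0 _]; exact: continuous_powR.
have mq : measurable_fun (`]0, 1[%classic : set R) (fun y : R => y `^ (q - 1)).
  by apply: open_continuous_measurable_fun => // x; rewrite inE; exact: cq.
have dq (x : R) : x \in `]0, 1[%R ->
    is_derive x (1 : R) (fun y : R => 1 - y `^ q) (- (q * x `^ (q - 1))).
  rewrite in_itv/= => /andP[x0 _].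
  have := is_deriveB (is_derive_cst (1 : R) x (1 : R)) (is_derive1_powR q x0).
  by rewrite sub0r.
(* The map [1 - y^q] is used instead of [y^q] because the rule is for decreasing maps. It sends []0,
   1[] onto itself, so the integral of [q * y^(q - 1)] is the length 1. *)
have := @ge0_integration_by_substitution_decreasing_oo R
  (fun y => 1 - y `^ q) (fun y => - (q * y `^ (q - 1))) (fun=> 1) 0 1 ltr01.
rewrite powR1 subrr powR0 ?gt_eqF// subr0 => /(_ _ dq) E.
have {}E : (\int[lebesgue_measure]_(x in `]0%R, 1%R[) (q * x `^ (q - 1))%:E
    = 1 :> \bar R)%E.
  transitivity (\int[lebesgue_measure]_(x in `]0%R, 1%R[) (1 * - - (q * x `^ (q - 1)))%:E)%E.
    by apply: eq_integral => x _; rewrite mul1r opprK.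
  rewrite -E.
  - rewrite integral_cst// mul1e.
    have := @lebesgue_measure_itv R `]0, 1[; rewrite /= lte01 sube0; exact.
  - apply/continuous_within_itvP => //; split.
    + move=> x xI; have := dq x xI => dqx.
      by apply: differentiable_continuous; apply/derivable1_diffP.
    + rewrite powR0 ?gt_eqF//; apply: cvgB; first exact: cvg_cst.
      exact: powR_cvg0.
    + apply: cvg_at_left_filter; apply: cvgB; first exact: cvg_cst.
      exact: continuous_powR.
  - move=> x; rewrite in_itv/= => /andP[x0 _].
    by rewrite oppr_lt0 mulr_gt0// powR_gt0.
  - move=> x /cq cx; apply: cvgN; apply: cvgM => //; exact: cvg_cst.
  - by move=> x _; exact: cvg_cst.
  - by [].
apply/integrableP; split; first exact/measurable_EFinP.
rewrite -(@lte_pmul2l _ q%:E)// -ge0_integralZl//=; last 2 first.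
- by apply/measurable_EFinP; exact: measurableT_comp.
- by rewrite lee_fin ltW.
rewrite mulry gtr0_sg// mul1e.
rewrite (_ : (\int[_]_(_ in _) _)%E = 1%E) ?ltry// -[RHS]E.
by apply: eq_integral => x _; rewrite ger0_norm ?powR_ge0// EFinM.
Qed.

Lemma integrable_powR01_onem (R : realType) (q : R) : 0 < q ->
  lebesgue_measure.-integrable `]0, 1[%classic
    (EFin \o (fun y : R => (1 - y) `^ (q - 1))).
Proof.
move=> q0; have /integrableP[_ fin] := integrable_powR01 q0.
have cq : {in `]0, 1[%R, continuous (fun y : R => y `^ (q - 1))}.
  by move=> x; rewrite in_itv/= => /andP[x0 _]; exact: continuous_powR.
apply/integrableP; split.
  apply/measurable_EFinP; apply: open_continuous_measurable_fun => // x.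
  rewrite inE/= in_itv/= => /andP[x0 x1].
  apply: (@continuous_comp _ _ _ (fun y : R => 1 - y) (fun y => y `^ (q - 1))).
    exact: continuous_onem.
  by apply: continuous_powR; rewrite subr_gt0.
have {}fin : (\int[lebesgue_measure]_(x in `]0%R, 1%R[) `|x `^ (q - 1)|%:E
  < +oo)%E by exact: fin.
move: fin; have := @ge0_integration_by_substitution_decreasing_oo R
  (fun y => 1 - y) (fun=> - 1) (fun y => `|y `^ (q - 1)|) 0 1 ltr01.
rewrite subrr subr0 => ->.
- by move=> h; apply: le_lt_trans h; rewrite le_eqVlt; apply/orP; left; apply/eqP;
  apply: eq_integral => x _; rewrite opprK mulr1.
- exact/continuous_subspaceT/continuous_onem.
- move=> x _.
  have := is_deriveB (is_derive_cst (1 : R) x (1 : R)) (is_derive_id x (1 : R)).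
  by rewrite sub0r.
- by move=> x _; rewrite ltrN10.
- by move=> x _; exact: cvg_cst.
- move=> x /cq cx; exact: cvg_norm.
- by [].
Qed.

(* On each half of ]0, 1[ one of the two factors is bounded. *)
Lemma integrable_beta_weight (R : realType) (p q : R) : 0 < p -> 0 < q ->
  lebesgue_measure.-integrable `]0, 1[%classic
    (EFin \o (fun y : R => y `^ (p - 1) * (1 - y) `^ (q - 1))).
Proof.
move=> p0 q0.
(* [C r] bounds [z^r] on [[1/2, 1]] for either sign of [r]: the term 1 serves [r >= 0], the term
   [(1/2)^r] serves [r < 0]. *)
pose C r : R := 1 + (1 / 2) `^ r.
have C_ge0 r : 0 <= C r by rewrite addr_ge0// powR_ge0.
have CP r z : 1 / 2 <= z -> z <= 1 -> z `^ r <= C r.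
  move=> z2 z1; have [r0|r0] := leP 0 r.
    rewrite (@le_trans _ _ 1) ?lerDl ?powR_ge0// powR_le1//.
    by apply: le_trans z2; lra.
  by rewrite ler_wpDl// le0_ger_powR// ?ltW//; lra.
have mW : measurable_fun (`]0, 1[%classic : set R)
    (fun y : R => y `^ (p - 1) * (1 - y) `^ (q - 1)).
  apply: open_continuous_measurable_fun => // x.
  rewrite inE/= in_itv/= => /andP[x0 x1]; apply: cvgM.
    exact: continuous_powR.
  apply: (@continuous_comp _ _ _ (fun y : R => 1 - y) (fun y => y `^ (q - 1))).
    exact: continuous_onem.
  by apply: continuous_powR; rewrite subr_gt0.
apply: (@le_integrable _ _ _ lebesgue_measure _ _ _
    (EFin \o (fun y : R => C (q - 1) * y `^ (p - 1)
      + C (p - 1) * (1 - y) `^ (q - 1)))) => //.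
- exact/measurable_EFinP.
- move=> y /=; rewrite in_itv/= => /andP[y0 y1].
  rewrite lee_fin !ger0_norm ?mulr_ge0 ?addr_ge0 ?powR_ge0 ?mulr_ge0 ?powR_ge0//.
  have [y2|y2] := leP y (1 / 2).
    rewrite ler_wpDr ?mulr_ge0 ?powR_ge0// mulrC ler_wpM2r ?powR_ge0// CP//; lra.
  rewrite ler_wpDl ?mulr_ge0 ?powR_ge0// ler_wpM2r ?powR_ge0// CP//; lra.
- rewrite (_ : EFin \o _ = (fun y : R => (C (q - 1))%:E * (y `^ (p - 1))%:E
      + (C (p - 1))%:E * ((1 - y) `^ (q - 1))%:E)%E)//.
  apply: integrableD => //.
    by apply: integrableZl => //; exact: integrable_powR01.
  by apply: integrableZl => //; exact: integrable_powR01_onem.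
Qed.

(** * Dominated integrals over the unit interval *)

Section integral01.
Context {R : realType}.
Local Notation mu := (@lebesgue_measure R).
Local Notation I01 := (`]0, 1[%classic : set R).

Lemma in01_continuous_measurable (f : R -> R) :
  {in `]0, 1[%R, continuous f} -> measurable_fun I01 f.
Proof.
by move=> cf; apply: open_continuous_measurable_fun => // x; rewrite inE; exact: cf.
Qed.

Lemma le_integrable01 (f w : R -> R) : mu.-integrable I01 (EFin \o w) ->
  {in `]0, 1[%R, continuous f} ->
  {in `]0, 1[%R, forall y, `|f y| <= w y} ->
  mu.-integrable I01 (EFin \o f).
Proof.
move=> iw cf fw; apply: (le_integrable _ _ _ iw) => //.
  by apply/measurable_EFinP; exact: in01_continuous_measurable.
move=> y yI; rewrite lee_fin (le_trans (fw _ yI))// ler_norm//.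
Qed.

Lemma normr_Rintegral01_le (f w : R -> R) : mu.-integrable I01 (EFin \o w) ->
  {in `]0, 1[%R, continuous f} ->
  {in `]0, 1[%R, forall y, `|f y| <= w y} ->
  `|\int[mu]_(y in I01) f y| <= \int[mu]_(y in I01) w y.
Proof.
move=> iw cf fw; have intf := le_integrable01 iw cf fw.
apply: le_trans (le_normr_Rintegral _ intf) _ => //.
apply: le_Rintegral => //.
exact: (integrable_norm intf).
Qed.

(** Dominated convergence: one integrable [w] serves every [x], so any neighbourhood of [x] will do;
    the proof takes []x - 1, x + 1[]. *)
Lemma continuous_Rintegral01 (f : R -> R -> R) (w : R -> R) :
  mu.-integrable I01 (EFin \o w) ->
  (forall x, {in `]0, 1[%R, continuous (f x)}) ->
  {in `]0, 1[%R, forall y, continuous (f ^~ y)} ->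
  (forall x, {in `]0, 1[%R, forall y, `|f x y| <= w y}) ->
  continuous (fun x => \int[mu]_(y in I01) f x y).
Proof.
move=> iw cf cfy fw x.
apply: (@continuity_under_integral _ _ _ mu f I01 _ (x - 1) (x + 1) _ _ w) => //.
- by move=> z _; exact: (le_integrable01 iw).
- by apply: aeW => y yI z _; exact: cfy.
- by move=> z _; apply: aeW => y yI; exact: fw.
- by rewrite inE/= in_itv/=; lra.
Qed.

End integral01.

(** * The profile of the derivative of [K] *)

Section profile.
Context {R : realType}.
Implicit Types a b x y : R.
Local Notation mu := (@lebesgue_measure R).
Local Notation I01 := (`]0, 1[%classic : set R).

(* Clamping to [0, 1] makes the functions of x = s / t below continuous on R. *)
Definition clamp x : R := Num.max 0 (Num.min 1 x).

Lemma clamp_ge0 x : 0 <= clamp x.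
Proof. by rewrite /clamp le_max lexx. Qed.

Lemma clamp_le1 x : clamp x <= 1.
Proof. by rewrite /clamp ge_max ler01 ge_min lexx. Qed.

Lemma clamp_id x : 0 <= x -> x <= 1 -> clamp x = x.
Proof. by move=> x0 x1; rewrite /clamp (min_idPr x1) (max_idPr x0). Qed.

Lemma continuous_clamp : continuous clamp.
Proof.
move=> x; apply: (@continuous_max _ R^o (cst 0) (Num.min 1)).
  exact: cvg_cst.
by apply: (@continuous_min _ R^o (cst 1) id); [exact: cvg_cst|exact: cvg_id].
Qed.

Definition beta_weight (p q y : R) := y `^ (p - 1) * (1 - y) `^ (q - 1).

Lemma beta_weight_ge0 p q y : 0 <= beta_weight p q y.
Proof. by rewrite mulr_ge0// powR_ge0. Qed.

Lemma continuous_beta_weight p q :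
  {in `]0, 1[%R, continuous (beta_weight p q)}.
Proof.
move=> y; rewrite in_itv/= => /andP[y0 y1]; apply: cvgM.
  exact: continuous_powR.
apply: (@continuous_comp _ _ _ (fun y : R => 1 - y) (fun y => y `^ (q - 1))).
  exact: continuous_onem.
by apply: continuous_powR; rewrite subr_gt0.
Qed.

(* t - (t - s) y = t * interp (s / t) y for 0 <= s <= t. *)
Definition interp x y : R := 1 - (1 - clamp x) * y.

Lemma interp_ge x y : y \in `]0, 1[%R -> 1 - y <= interp x y.
Proof.
rewrite in_itv/= /interp => /andP[y0 y1].
by have := clamp_ge0 x; nra.
Qed.

Lemma interp_gt0 x y : y \in `]0, 1[%R -> 0 < interp x y.
Proof.
move=> yI; apply: lt_le_trans (interp_ge x yI).
by move: yI; rewrite in_itv/=; lra.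
Qed.

Lemma interp_le1 x y : y \in `]0, 1[%R -> interp x y <= 1.
Proof.
rewrite in_itv/= /interp => /andP[y0 y1].
by have := clamp_le1 x; nra.
Qed.

Lemma continuous_interpl y : continuous (interp ^~ y).
Proof.
move=> x; apply: cvgB; first exact: cvg_cst.
apply: cvgM; last exact: cvg_cst.
by apply: cvgB; [exact: cvg_cst|exact: continuous_clamp].
Qed.

Lemma continuous_interpr x : continuous (interp x).
Proof.
move=> y; apply: cvgB; first exact: cvg_cst.
by apply: cvgM; [exact: cvg_cst|exact: cvg_id].
Qed.

(** With [m = t - (t - s) y] and [x = s / t], this is [m^c + (t - s) (1 - y) m^(c - 1)] divided by
    [t^c], the bracket that the product rule produces when [(t - s)^c m^c] is differentiated in
    [t]. *)
Definition profile_term (c x y : R) :=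
  interp x y `^ c + (1 - clamp x) * ((1 - y) * interp x y `^ (c - 1)).

Lemma profile_term_ge0 c x y : y \in `]0, 1[%R -> 0 <= profile_term c x y.
Proof.
rewrite in_itv/= => /andP[y0 y1].
by rewrite addr_ge0 ?mulr_ge0 ?powR_ge0 ?subr_ge0 ?clamp_le1// ltW.
Qed.

(** Each summand is at most 1. The negative power [interp^(c - 1)] is unbounded near [x = 0],
    [y = 1], but [1 - y <= interp] turns its product with [1 - y] into at most [interp^c <= 1]. *)
Lemma profile_term_le2 c x y : 0 <= c -> c <= 1 -> y \in `]0, 1[%R ->
  profile_term c x y <= 2.
Proof.
move=> c0 c1 yI; have := yI; rewrite in_itv/= => /andP[y0 y1].
have m0 := interp_gt0 x yI; have m1 := interp_le1 x yI.
rewrite /profile_term; apply: (@le_trans _ _ (1 + 1)); last by [].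
rewrite lerD ?powR_le1 ?(ltW m0)//.
rewrite -[leRHS]mulr1 ler_pM ?mulr_ge0 ?powR_ge0//.
- by rewrite subr_ge0 clamp_le1.
- by rewrite subr_ge0 ltW.
- by rewrite gerBl clamp_ge0.
- apply: le_trans (_ : interp x y * interp x y `^ (c - 1) <= _).
    by rewrite ler_wpM2r ?powR_ge0// interp_ge.
  rewrite -[X in X * _]powRr1 ?(ltW m0)// -powRD ?(gt_eqF m0) ?implybT//.
  by rewrite powR_le1 ?(ltW m0)//; lra.
Qed.

Lemma continuous_profile_terml c y : y \in `]0, 1[%R ->
  continuous (profile_term c ^~ y).
Proof.
move=> yI x; have m0 := interp_gt0 x yI.
have cp r : {for x, continuous (fun x => interp x y `^ r)}.
  apply: (@continuous_comp _ _ _ (interp ^~ y) (fun z => z `^ r)).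
    exact: continuous_interpl.
  exact: continuous_powR.
apply: cvgD; first exact: cp.
apply: cvgM; first by apply: cvgB; [exact: cvg_cst|exact: continuous_clamp].
by apply: cvgM; [exact: cvg_cst|exact: cp].
Qed.

Lemma continuous_profile_termr c x : {in `]0, 1[%R, continuous (profile_term c x)}.
Proof.
move=> y yI; have m0 := interp_gt0 x yI.
have cp r : {for y, continuous (fun y => interp x y `^ r)}.
  apply: (@continuous_comp _ _ _ (interp x) (fun z => z `^ r)).
    exact: continuous_interpr.
  exact: continuous_powR.
apply: cvgD; first exact: cp.
apply: cvgM; first exact: cvg_cst.
by apply: cvgM; [exact: continuous_onem|exact: cp].
Qed.

(* The function g of the header. *)
Definition profile a b x : R :=
  \int[mu]_(y in I01) (beta_weight (1 - a) b y * profile_term (b - a) x y).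

Section bounds.
Variables a b : R.
Hypotheses (a1 : a < 1) (b0 : 0 < b) (ab : a <= b) (ba1 : b - a <= 1).

Let iw : mu.-integrable I01 (EFin \o (fun y => beta_weight (1 - a) b y * 2)).
Proof.
rewrite (_ : EFin \o _ = (fun y => 2%:E * (beta_weight (1 - a) b y)%:E)%E); last first.
  by apply/funext => y /=; rewrite -EFinM mulrC.
apply: integrableZl => //; apply: integrable_beta_weight => //.
by rewrite subr_gt0.
Qed.

Let le2 x : {in `]0, 1[%R, forall y,
  `|beta_weight (1 - a) b y * profile_term (b - a) x y|
  <= beta_weight (1 - a) b y * 2}.
Proof.
move=> y yI; rewrite ger0_norm; last first.
  by apply: mulr_ge0; [exact: beta_weight_ge0|exact: profile_term_ge0].
apply: ler_wpM2l; first exact: beta_weight_ge0.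
by apply: profile_term_le2 => //; rewrite subr_ge0.
Qed.

Let cr x : {in `]0, 1[%R,
  continuous (fun y => beta_weight (1 - a) b y * profile_term (b - a) x y)}.
Proof.
move=> y yI; apply: cvgM; first exact: continuous_beta_weight.
exact: continuous_profile_termr.
Qed.

Lemma integrable_profile x : mu.-integrable I01
  (EFin \o (fun y => beta_weight (1 - a) b y * profile_term (b - a) x y)).
Proof. exact: (le_integrable01 iw). Qed.

Lemma continuous_profile : continuous (profile a b).
Proof.
apply: (continuous_Rintegral01 iw) => // y yI x.
by apply: cvgM; [exact: cvg_cst|exact: continuous_profile_terml].
Qed.

Lemma profile_bounded : exists M, forall x, `|profile a b x| <= M.
Proof.
by eexists => x; exact: (normr_Rintegral01_le iw).
Qed.

End bounds.

Lemma profile_ge0 a b x : 0 <= profile a b x.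
Proof.
apply: Rintegral_ge0 => y yI.
by apply: mulr_ge0; [exact: beta_weight_ge0|exact: profile_term_ge0].
Qed.

End profile.

(** * The derivative of [K] in its first argument *)

Section kernel_derivative.
Context {R : realType}.
Local Notation mu := (@lebesgue_measure R).
Local Notation I01 := (`]0, 1[%classic : set R).
Variables H1 H2 s : R.
Hypotheses (hH1 : 1 / 2 <= H1) (hH12 : H1 < H2) (hH2 : H2 < 1) (s_gt0 : 0 < s).

Let a := H1 - 1 / 2.
Let b := H2 - 1 / 2.
Let c := b - a.
Let w := beta_weight (1 - a) b.
Let m (t y : R) : R := t - (t - s) * y.
Let J (t : R) : R := \int[mu]_(y in I01) (w y * m t y `^ c).
Let L (t : R) : R := \int[mu]_(y in I01) (w y * ((1 - y) * m t y `^ (c - 1))).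

Let c_gt0 : 0 < c. Proof. by rewrite /c /a /b; move: hH1 hH12 hH2; lra. Qed.
Let c_lt1 : c < 1. Proof. by rewrite /c /a /b; move: hH1 hH12 hH2; lra. Qed.
Let iw : mu.-integrable I01 (EFin \o w).
Proof. by apply: integrable_beta_weight; rewrite /a /b; move: hH1 hH12 hH2; lra. Qed.

Let iZw r : mu.-integrable I01 (EFin \o (fun y => r * w y)).
Proof.
rewrite (_ : EFin \o _ = (fun y => r%:E * (w y)%:E)%E); last first.
  by apply/funext => y.
exact: integrableZl.
Qed.

Let w_ge0 y : 0 <= w y. Proof. exact: beta_weight_ge0. Qed.

Let m_ge t y : s < t -> y \in `]0, 1[%R -> s <= m t y.
Proof. by rewrite in_itv/= /m; move: s_gt0 => s0 st /andP[y0 y1]; nra. Qed.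

Let m_le t y : s < t -> y \in `]0, 1[%R -> m t y <= t.
Proof. by rewrite in_itv/= /m; move: s_gt0 => s0 st /andP[y0 y1]; nra. Qed.

Let m_gt0 t y : s < t -> y \in `]0, 1[%R -> 0 < m t y.
Proof. by move=> st yI; apply: lt_le_trans s_gt0 _; exact: m_ge. Qed.

Let cw_m t r : s < t ->
  {in `]0, 1[%R, continuous (fun y => w y * m t y `^ r)}.
Proof.
move=> st y yI; apply: cvgM; first exact: continuous_beta_weight.
apply: (@continuous_comp _ _ _ (m t) (fun z => z `^ r)).
  by apply: cvgB; [exact: cvg_cst|apply: cvgM; [exact: cvg_cst|exact: cvg_id]].
exact/continuous_powR/m_gt0.
Qed.

Let iJ t : s < t -> mu.-integrable I01 (EFin \o (fun y => w y * m t y `^ c)).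
Proof.
move=> st; apply: (le_integrable01 (iZw (t `^ c))); first exact: cw_m.
move=> y yI; rewrite ger0_norm; last first.
  by apply: mulr_ge0; [exact: w_ge0|exact: powR_ge0].
rewrite mulrC; apply: ler_wpM2r; first exact: w_ge0.
apply: ge0_ler_powR; rewrite ?nnegrE ?(ltW c_gt0) ?(ltW (m_gt0 _ _))//.
  by rewrite (le_trans (ltW s_gt0)) ?ltW.
exact: m_le.
Qed.

Let iL t : s < t ->
  mu.-integrable I01 (EFin \o (fun y => w y * ((1 - y) * m t y `^ (c - 1)))).
Proof.
move=> st; apply: (le_integrable01 (iZw (s `^ (c - 1)))).
  move=> y yI; under eq_fun do rewrite mulrCA.
  by apply: cvgM; [exact: continuous_onem|exact: cw_m].
move=> y yI; have := yI; rewrite in_itv/= => /andP[y0 y1].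
have y1' : 0 <= 1 - y by rewrite subr_ge0 ltW.
have p0 : 0 <= m t y `^ (c - 1) by exact: powR_ge0.
rewrite ger0_norm; last first.
  by apply: mulr_ge0; [exact: w_ge0|exact: mulr_ge0].
rewrite mulrC; apply: ler_wpM2r; first exact: w_ge0.
rewrite -[leRHS]mul1r; apply: ler_pM => //; first by lra.
by apply: le0_ger_powR; rewrite ?subr_le0 ?(ltW c_lt1)//; exact: m_ge.
Qed.

(** Under [u = m t y] one has [t - u = (t - s) y] and [u - s = (t - s) (1 - y)]. Together with the
    Jacobian [t - s], the extracted exponents add up to [- a + (b - 1) + 1 = c]. *)
Lemma K_substitution t : s < t ->
  K H1 H2 t s = beta_const H2 * s `^ (1 / 2 - H2) * ((t - s) `^ c * J t).
Proof.
move=> st; rewrite /K; congr (_ * _).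
have ts0 : 0 < t - s by rewrite subr_gt0.
have FsE : m t 1 = s by rewrite /m; ring.
have FtE : m t 0 = t by rewrite /m; ring.
pose G u : R := (t - u) `^ (1 / 2 - H1) * u `^ (H2 - H1) * (u - s) `^ (H2 - 3 / 2).
rewrite -RintegralZl//; last exact: iJ.
have := @ge0_integration_by_substitution_decreasing_oo R
  (m t) (fun=> - (t - s)) G 0 1 ltr01.
rewrite FsE FtE => E; rewrite /Rintegral; congr fine; rewrite E.
- apply: eq_integral => y; rewrite inE => yI.
  congr (EFin _); rewrite opprK /G.
  have m0 := m_gt0 st yI; have := yI; rewrite /= in_itv/= => /andP[y0 y1].
  have -> : t - m t y = (t - s) * y by rewrite /m; ring.
  have -> : m t y - s = (t - s) * (1 - y) by rewrite /m; ring.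
  rewrite !powRM ?(ltW ts0) ?(ltW y0) ?subr_ge0 ?(ltW y1)//.
  have -> : 1 / 2 - H1 = 1 - a - 1 by rewrite /a; ring.
  have -> : H2 - 3 / 2 = b - 1 by rewrite /b; field.
  have -> : H2 - H1 = c by rewrite /c /a /b; ring.
  have <- : (t - s) `^ (1 - a - 1) * (t - s) `^ (b - 1) * (t - s) = (t - s) `^ c.
    rewrite -[X in _ * X]powRr1 ?(ltW ts0)// -!powRD ?(gt_eqF ts0) ?implybT//.
    by congr (_ `^ _); rewrite /c; ring.
  by rewrite /w /beta_weight; ring.
- apply: continuous_subspaceT => y.
  by apply: cvgB; [exact: cvg_cst|apply: cvgM; [exact: cvg_cst|exact: cvg_id]].
- move=> y _; have := is_deriveB (is_derive_cst t y (1 : R))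
    (is_deriveZ (t - s) (is_derive_id y (1 : R))).
  by rewrite sub0r /GRing.scale/= mulr1.
- by move=> y _; rewrite oppr_lt0.
- by move=> y _; exact: cvg_cst.
- move=> u; rewrite in_itv/= => /andP[su ut].
  apply: cvgM; first apply: cvgM.
  + apply: (@continuous_comp _ _ _ (fun u : R => t - u) (fun z => z `^ _)).
      by apply: cvgB; [exact: cvg_cst|exact: cvg_id].
    by apply: continuous_powR; rewrite subr_gt0.
  + by apply: continuous_powR; exact: lt_trans su.
  + apply: (@continuous_comp _ _ _ (fun u : R => u - s) (fun z => z `^ _)).
      by apply: cvgB; [exact: cvg_id|exact: cvg_cst].
    by apply: continuous_powR; rewrite subr_gt0.
- by move=> u _; rewrite /G !mulr_ge0 ?powR_ge0.
Qed.

Let dm x y : s < x -> y \in `]0, 1[%R ->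
  is_derive x (1 : R) (fun x => w y * m x y `^ c)
    (w y * (c * m x y `^ (c - 1) * (1 - y))).
Proof.
move=> sx yI.
have dlin : is_derive x (1 : R) (m ^~ y) (1 - y).
  have := is_deriveB (is_derive_id x (1 : R))
    (is_deriveM (is_deriveB (is_derive_id x (1 : R)) (is_derive_cst s x (1 : R)))
      (is_derive_cst y x (1 : R))).
  by rewrite /GRing.scale/= subr0 mulr0 add0r mulr1.
have dp := is_derive1_powR c (m_gt0 sx yI).
have := is_deriveZ (w y) (@is_derive1_comp _ _ (m ^~ y) _ _ _ dp dlin).
by rewrite /GRing.scale.
Qed.

(** Differentiation under the integral sign. For [x > s] the base satisfies [m x y >= s > 0], and
    since [c < 1] this bounds [m^(c - 1)] by [s^(c - 1)]: the majorant [c * s^(c - 1) * w] does not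
    depend on [x]. *)
Lemma is_derive_J t : s < t -> is_derive t (1 : R) J (c * L t).
Proof.
move=> st.
have d1E x y : s < x -> y \in `]0, 1[%R ->
    partial1of2 (fun x y => w y * m x y `^ c) x y
    = w y * (c * m x y `^ (c - 1) * (1 - y)).
  by move=> sx yI; rewrite partial1of2E; have [_ ->] := dm sx yI.
have tI : `]s, t + 1[%classic t by rewrite /= in_itv/= st ltrDl ltr01.
have bd x y : `]s, t + 1[%classic x -> I01 y ->
    `|partial1of2 (fun x y => w y * m x y `^ c) x y|
    <= c * s `^ (c - 1) * w y.
  rewrite /= in_itv/= => /andP[sx _] yI; rewrite d1E//.
  have := yI; rewrite in_itv/= => /andP[y0 y1].
  have y1' : 0 <= 1 - y by rewrite subr_ge0 ltW.
  have p0 : 0 <= m x y `^ (c - 1) by exact: powR_ge0.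
  have cp0 : 0 <= c * m x y `^ (c - 1) by rewrite mulr_ge0// ltW.
  rewrite ger0_norm; last first.
    by apply: mulr_ge0; [exact: w_ge0|exact: mulr_ge0].
  rewrite mulrC; apply: ler_wpM2r; first exact: w_ge0.
  rewrite -[leRHS]mulr1; apply: ler_pM => //; last by lra.
  apply: ler_wpM2l; first exact: ltW.
  by apply: le0_ger_powR; rewrite ?subr_le0 ?(ltW c_lt1)//; exact: m_ge.
have G0 y : 0 <= c * s `^ (c - 1) * w y.
  apply: mulr_ge0; last exact: w_ge0.
  by rewrite mulr_ge0 ?powR_ge0// ltW.
have iI x : `]s, t + 1[%classic x ->
    mu.-integrable I01 (EFin \o (fun y => w y * m x y `^ c)).
  by rewrite /= in_itv/= => /andP[sx _]; apply: iJ.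
have dI x y : `]s, t + 1[%classic x -> I01 y ->
    derivable (fun x => w y * m x y `^ c) x 1.
  by rewrite /= in_itv/= => /andP[sx _] yI; have [] := dm sx yI.
have mI : measurable (I01 : set (measurableTypeR R)) by [].
split.
  exact: (derivable_under_integral mI tI iI dI G0 (iZw (c * s `^ (c - 1))) bd).
rewrite -derive1E.
rewrite (differentiation_under_integral mI tI iI dI G0 (iZw (c * s `^ (c - 1))) bd).
rewrite /L -RintegralZl//; last exact: iL.
apply: eq_Rintegral => y; rewrite inE => yI.
by rewrite d1E//; ring.
Qed.

(** Homogeneity: [m t y] is [t] times [interp (s / t) y], and [t - s = t (1 - s / t)], so both
    integrands contain the factor [t^c]. *)
Lemma JL_profile t : s < t -> J t + (t - s) * L t = t `^ c * profile a b (s / t).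
Proof.
move=> st; have t0 : 0 < t by exact: lt_trans st.
have x1 : s / t <= 1 by rewrite ler_pdivrMr// mul1r ltW.
have x0 : 0 <= s / t by rewrite divr_ge0// ltW.
rewrite /profile /J /L -[in RHS]RintegralZl//; last first.
  by apply: integrable_profile; rewrite -/c ?(ltW c_lt1)//;
    move: c_gt0; rewrite /c /a /b; move: hH1 hH12 hH2; lra.
rewrite -[X in _ + X]RintegralZl//; last exact: iL.
rewrite -RintegralD//; last 2 first.
- exact: iJ.
- rewrite (_ : EFin \o _ = (fun y => (t - s)%:E *
      (w y * ((1 - y) * m t y `^ (c - 1)))%:E)%E); last by apply/funext => y.
  by apply: integrableZl => //; exact: iL.
apply: eq_Rintegral => y; rewrite inE => yI.
rewrite /profile_term /interp clamp_id//.
have mE : m t y = t * (1 - (1 - s / t) * y).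
  by rewrite /m; field; rewrite gt_eqF.
have i0 : 0 < 1 - (1 - s / t) * y.
  by rewrite -(pmulr_rgt0 _ t0) -mE; exact: m_gt0.
rewrite mE !powRM ?(ltW t0) ?(ltW i0)//.
have -> : t `^ c = t * t `^ (c - 1) by rewrite mulr_powRB1// ltW.
rewrite -/c -/w; field; rewrite gt_eqF//.
Qed.

Lemma dK_profile t : s < t ->
  dK H1 H2 t s = beta_const H2 * c * s `^ (1 / 2 - H2) * (t - s) `^ (c - 1)
    * (t `^ c * profile a b (s / t)).
Proof.
move=> st; rewrite -JL_profile// /dK derive1E.
(* The substituted form of [K] is available only for [x > s], a neighbourhood of [t], which suffices
   for the derivative at [t]. The product rule then gives [c (t - s)^(c - 1) (J + (t - s) L)]. *)
rewrite (@near_eq_derive _ _ _ _ (fun x : R =>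
  beta_const H2 * s `^ (1 / 2 - H2) * ((x - s) `^ c * J x))); last first.
  near=> x; apply: K_substitution; near: x.
  exact: lt_nbhsr.
have ts0 : 0 < t - s by rewrite subr_gt0.
have dlin := is_deriveB (is_derive_id t (1 : R)) (is_derive_cst s t (1 : R)).
have dp := @is_derive1_comp _ _ (fun x => x - s) _ _ _ (is_derive1_powR c ts0) dlin.
have [_ ->] := is_deriveZ (beta_const H2 * s `^ (1 / 2 - H2))
  (is_deriveM dp (is_derive_J st)).
rewrite /GRing.scale/= subr0 mulr1.
have -> : (t - s) `^ c = (t - s) * (t - s) `^ (c - 1) by rewrite mulr_powRB1// ltW.
ring.
Unshelve. all: by end_near. Qed.

End kernel_derivative.

(** * The powers in the Moebius substitution *)

Lemma powR_expR (R : realType) (x p : R) : 0 < x -> x `^ p = expR (p * ln x).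
Proof. by move=> x0; rewrite /powR gt_eqF. Qed.

(* The powers in the substitution v = s z / D, with z = 1 - y, D = 1 - (s / u) y
   and A = u - s; the last factor on the left is |dv / dy|. *)
Lemma mobius_power_identity (R : realType) (s u A y z D a b : R) :
  0 < s -> 0 < u -> 0 < A -> 0 < y -> 0 < z -> 0 < D ->
  ((s * z / D) `^ (- b) * (s / u * y * A / D) `^ (b - a - 1) * s `^ (b - a))
  * ((s * z / D) `^ (- b) * (A / D) `^ (b - a - 1) * u `^ (b - a))
  * (A * (s / u) / D ^+ 2)
  = s `^ (- (2 * a)) * A `^ (2 * (b - a) - 1)
    * (y `^ (b - a - 1) * z `^ (- (2 * b)) * D `^ (2 * a)).
Proof.
move=> s0 u0 A0 y0 z0 D0.
have D'0 : 0 < D^-1 by rewrite invr_gt0.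
have u'0 : 0 < u^-1 by rewrite invr_gt0.
(* All bases are positive, so each side becomes the exponential of a combination of logarithms, and
   [ring] compares the exponents. *)
have -> : A * (s / u) / D ^+ 2 = expR (ln A + (ln s - ln u) - 2 * ln D).
  by rewrite !(expRD, expRN) expRM_natl !lnK ?posrE.
rewrite !powR_expR ?mulr_gt0// !lnM ?posrE ?mulr_gt0// !lnV ?posrE// -!expRD.
by congr expR; ring.
Qed.

(** * The integral defining the bounded factor *)

Section limit_profile.
Context {R : realType}.
Implicit Types a b x y : R.
Local Notation mu := (@lebesgue_measure R).
Local Notation I01 := (`]0, 1[%classic : set R).

Definition denom x y : R := 1 - clamp x * y.

Lemma denom_gt0 x y : y \in `]0, 1[%R -> 0 < denom x y.
Proof.
rewrite in_itv/= /denom => /andP[y0 y1].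
by have := clamp_ge0 x; have := clamp_le1 x; nra.
Qed.

Lemma denom_le1 x y : y \in `]0, 1[%R -> denom x y <= 1.
Proof.
rewrite in_itv/= /denom => /andP[y0 y1].
by have := clamp_ge0 x; nra.
Qed.

Lemma continuous_denoml y : continuous (denom ^~ y).
Proof.
move=> x; apply: cvgB; first exact: cvg_cst.
by apply: cvgM; [exact: continuous_clamp|exact: cvg_cst].
Qed.

Lemma continuous_denomr x : continuous (denom x).
Proof.
move=> y; apply: cvgB; first exact: cvg_cst.
by apply: cvgM; [exact: cvg_cst|exact: cvg_id].
Qed.

Definition kappa0_term a b x y : R :=
  beta_weight (b - a) (1 - 2 * b) y *
  (denom x y `^ (2 * a) *
   (profile a b ((1 - y) / denom x y) *
    profile a b (clamp x * ((1 - y) / denom x y)))).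

Definition kappa0_integral a b x : R := \int[mu]_(y in I01) kappa0_term a b x y.

Section bounds.
Variables a b : R.
Hypotheses (a0 : 0 <= a) (ab : a < b) (b2 : b < 1 / 2).

Let cprofile : continuous (profile a b).
Proof.
by apply: continuous_profile; move: a0 ab b2; lra.
Qed.

Let iw M : mu.-integrable I01
  (EFin \o (fun y => beta_weight (b - a) (1 - 2 * b) y * M)).
Proof.
rewrite (_ : EFin \o _ = (fun y => M%:E * (beta_weight (b - a) (1 - 2 * b) y)%:E)%E); last first.
  by apply/funext => y /=; rewrite -EFinM mulrC.
apply: integrableZl => //; apply: integrable_beta_weight.
  by rewrite subr_gt0.
by move: b2; lra.
Qed.

Let bound : exists M, forall x, {in `]0, 1[%R, forall y,
  `|kappa0_term a b x y| <= beta_weight (b - a) (1 - 2 * b) y * M}.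
Proof.
have [||||M pM] := @profile_bounded R a b; [by move: a0 ab b2; lra..|].
(* Each profile factor is at most [M], and [denom^(2 a) <= 1] because [a >= 0] and
   [0 < denom <= 1]. *)
exists (M * M) => x y yI.
rewrite /kappa0_term normrM (ger0_norm (beta_weight_ge0 _ _ _)).
apply: ler_wpM2l; first exact: beta_weight_ge0.
rewrite normrM (ger0_norm (powR_ge0 _ _)) -[leRHS]mul1r.
apply: ler_pM => //; first exact: powR_ge0.
  apply: powR_le1; [by rewrite mulr_ge0|exact/ltW/denom_gt0|exact: denom_le1].
by rewrite normrM; apply: ler_pM.
Qed.

Let crat_l y : y \in `]0, 1[%R -> continuous (fun x => (1 - y) / denom x y).
Proof.
move=> yI x; apply: cvgM; first exact: cvg_cst.
apply: cvgV; last exact: continuous_denoml.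
by rewrite gt_eqF// denom_gt0.
Qed.

Let crat_r x : {in `]0, 1[%R, continuous (fun y => (1 - y) / denom x y)}.
Proof.
move=> y yI; apply: cvgM; first exact: continuous_onem.
apply: cvgV; last exact: continuous_denomr.
by rewrite gt_eqF// denom_gt0.
Qed.

Let cr x : {in `]0, 1[%R, continuous (kappa0_term a b x)}.
Proof.
move=> y yI; apply: cvgM; first exact: continuous_beta_weight.
apply: cvgM.
  apply: (@continuous_comp _ _ _ (denom x) (fun z => z `^ _)).
    exact: continuous_denomr.
  exact/continuous_powR/denom_gt0.
apply: cvgM.
  apply: (@continuous_comp _ _ _ (fun y => (1 - y) / denom x y) (profile a b)).
    exact: crat_r.
  exact: cprofile.
apply: (@continuous_comp _ _ _ (fun y => clamp x * ((1 - y) / denom x y))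
  (profile a b)); last exact: cprofile.
by apply: cvgM; [exact: cvg_cst|exact: crat_r].
Qed.

Lemma continuous_kappa0_integral : continuous (kappa0_integral a b).
Proof.
have [M hM] := bound.
apply: (continuous_Rintegral01 (iw M) cr _ hM) => y yI x.
apply: cvgM; first exact: cvg_cst.
apply: cvgM.
  apply: (@continuous_comp _ _ _ (denom ^~ y) (fun z => z `^ _)).
    exact: continuous_denoml.
  exact/continuous_powR/denom_gt0.
apply: cvgM.
  apply: (@continuous_comp _ _ _ (fun x => (1 - y) / denom x y) (profile a b)).
    exact: crat_l.
  exact: cprofile.
apply: (@continuous_comp _ _ _ (fun x => clamp x * ((1 - y) / denom x y))
  (profile a b)); last exact: cprofile.
by apply: cvgM; [exact: continuous_clamp|exact: crat_l].
Qed.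

Lemma kappa0_integral_bounded :
  exists M, forall x, `|kappa0_integral a b x| <= M.
Proof.
have [M hM] := bound; eexists => x.
by apply: (normr_Rintegral01_le (iw M)); [exact: cr|exact: hM].
Qed.

Lemma integrable_kappa0_term x :
  mu.-integrable I01 (EFin \o kappa0_term a b x).
Proof.
have [M hM] := bound.
by apply: (le_integrable01 (iw M)); [exact: cr|exact: hM].
Qed.

End bounds.
End limit_profile.

(** * Evaluation of [k] and [kappa] off the diagonal *)

Lemma k_integral (R : realType) (H1 H2 s u : R)
    (a := H1 - 1 / 2) (b := H2 - 1 / 2) :
  1 / 2 <= H1 -> H1 < H2 -> H2 < 1 -> 0 < s -> s < u ->
  k H1 H2 s u = s `^ (- (2 * a)) * (u - s) `^ (2 * (b - a) - 1) *
    ((beta_const H2 * (b - a)) ^+ 2 * kappa0_integral a b (s / u)).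
Proof.
move=> hH1 hH12 hH2 s0 su.
have a0 : 0 <= a by rewrite /a; lra.
have ab : a < b by rewrite /a /b; lra.
have b2 : b < 1 / 2 by rewrite /b; lra.
have u0 : 0 < u by exact: lt_trans su.
have us0 : 0 < u - s by rewrite subr_gt0.
have cprof : continuous (profile a b) by apply: continuous_profile; lra.
pose x := s / u.
have x0 : 0 < x by rewrite divr_gt0.
have x1 : x < 1 by rewrite ltr_pdivrMr// mul1r.
have clx : clamp x = x by rewrite clamp_id// ltW.
have xu : x * u = s by rewrite /x divfK// gt_eqF.
(* [d] is the closed form of [dK]; unlike the derivative itself, it is visibly continuous and
   nonnegative, as the substitution rule demands. *)
pose d t v : R := beta_const H2 * (b - a) * v `^ (1 / 2 - H2)
  * (t - v) `^ (b - a - 1) * (t `^ (b - a) * profile a b (v / t)).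
have dKE t v : 0 < v -> v < t -> dK H1 H2 t v = d t v.
  by move=> v0 vt; exact: dK_profile.
have d_ge0 t v : 0 <= d t v.
  rewrite !mulr_ge0 ?powR_ge0 ?profile_ge0//.
  by rewrite subr_ge0 ltW.
have cd t v : 0 < v -> v < t -> {for v, continuous (d t)}.
  move=> v0 vt; apply: cvgM; first apply: cvgM; first apply: cvgM.
  - exact: cvg_cst.
  - exact: continuous_powR.
  - apply: (@continuous_comp _ _ _ (fun v : R => t - v) (fun z => z `^ _)).
      by apply: cvgB; [exact: cvg_cst|exact: cvg_id].
    by apply: continuous_powR; rewrite subr_gt0.
  - apply: cvgM; first exact: cvg_cst.
    apply: (@continuous_comp _ _ _ (fun v : R => v / t) (profile a b)).
      by apply: cvgM; [exact: cvg_id|exact: cvg_cst].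
    exact: cprof.
(* This is the Moebius map [s (1 - y) / (1 - x y)], written so that [u - F y] and the derivative can
   be read off; [FE] recovers the quotient form. *)
pose F y : R := u - (u - s) * (denom x y)^-1.
pose f y : R := - ((u - s) * (s / u) / denom x y ^+ 2).
(* Since [s < u], [x < 1] strictly, so the denominator is positive at [y = 1] too and [F] is
   continuous on the closed interval. *)
have D0 y : 0 <= y -> y <= 1 -> 0 < denom x y.
  by move=> y0 y1; rewrite /denom clx; nra.
have FE y : 0 <= y -> y <= 1 -> F y = s * (1 - y) / denom x y.
  move=> y0 y1; have Dy := D0 _ y0 y1; apply: (mulIf (negbT (gt_eqF Dy))).
  rewrite divfK ?gt_eqF// mulrBl mulfVK ?gt_eqF//.
  by rewrite /denom clx -xu; ring.
have F0 : F 0 = s by rewrite FE// /denom mulr0 !subr0 invr1 !mulr1.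
have F1 : F 1 = 0 by rewrite FE// subrr mulr0 mul0r.
rewrite /k (min_idPl (ltW su)).
rewrite (_ : Rintegral _ _ _ =
    \int[lebesgue_measure]_(v in `]0, s[) (d s v * d u v)); last first.
  apply: eq_Rintegral => v; rewrite inE/= in_itv/= => /andP[v0 vs].
  by rewrite !dKE// (lt_trans vs).
rewrite -RintegralZl//; last exact: integrable_kappa0_term.
rewrite -RintegralZl//; last first.
  rewrite (_ : EFin \o _ = (fun y => ((beta_const H2 * (b - a)) ^+ 2)%:E *
      (kappa0_term a b (s / u) y)%:E)%E); last by apply/funext.
  by apply: integrableZl => //; exact: integrable_kappa0_term.
have := @ge0_integration_by_substitution_decreasing_oo R F f
  (fun v => d s v * d u v) 0 1 ltr01.
have cF y : 0 < denom x y -> {for y, continuous F}.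
  move=> Dy; apply: cvgB; first exact: cvg_cst.
  apply: cvgM; first exact: cvg_cst.
  by apply: cvgV; [rewrite gt_eqF|exact: continuous_denomr].
(* This separates the constant [B] and the profile values [p1], [p2] from the pure powers, whose
   identity is [mobius_power_identity]. *)
have alg (B p1 p2 X1 X2 X3 X4 X5 J S A Y Z W : R) :
    X1 * X2 * X3 * (X1 * X4 * X5) * J = S * A * (Y * Z * W) ->
    B * X1 * X2 * (X3 * p1) * (B * X1 * X4 * (X5 * p2)) * J
    = S * A * (B ^+ 2 * (Y * Z * (W * (p1 * p2)))).
  move=> h; transitivity (B ^+ 2 * (p1 * p2) *
    (X1 * X2 * X3 * (X1 * X4 * X5) * J)); first by ring.
  by rewrite h; ring.
rewrite F0 F1 => E; rewrite /Rintegral; congr fine; rewrite E.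
- apply: eq_integral => y; rewrite inE => yI; congr (EFin _).
  have := yI; rewrite /= in_itv/= => /andP[y0 y1].
  have Dy := denom_gt0 x yI.
  have sF : s - F y = s / u * y * (u - s) / denom x y.
    rewrite FE ?ltW//; apply: (mulIf (negbT (gt_eqF Dy))).
    rewrite mulrBl !divfK ?gt_eqF// -/x /denom clx -xu; ring.
  have uF : u - F y = (u - s) / denom x y by rewrite /F; ring.
  have Fs : F y / s = (1 - y) / denom x y.
    by rewrite FE ?ltW//; field; rewrite !gt_eqF.
  have Fu : F y / u = clamp x * ((1 - y) / denom x y).
    by rewrite FE ?ltW// clx /x; field; rewrite !gt_eqF.
  rewrite /f opprK /d Fs Fu sF uF FE ?ltW// /kappa0_term -/x.
  have y1' : 0 < 1 - y by rewrite subr_gt0.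
  have key := @mobius_power_identity R s u (u - s) y (1 - y) (denom x y) a b
    s0 u0 us0 y0 y1' Dy.
  have -> : 1 / 2 - H2 = - b by rewrite /b; ring.
  have -> : beta_weight (b - a) (1 - 2 * b) y
      = y `^ (b - a - 1) * (1 - y) `^ (- (2 * b)).
    by rewrite /beta_weight; congr (_ * _ `^ _); ring.
  exact: alg key.
- apply: continuous_in_subspaceT => y; rewrite inE/= in_itv/= => /andP[y0 y1].
  exact/cF/D0.
- move=> y; rewrite in_itv/= => /andP[y0 y1].
  have Dn0 : denom x y != 0 by rewrite gt_eqF// D0// ltW.
  have dD := is_deriveB (is_derive_cst (1 : R) y (1 : R))
    (is_deriveZ (clamp x) (is_derive_id y (1 : R))).
  have := is_deriveB (is_derive_cst u y (1 : R))
    (is_deriveZ (u - s) (@is_deriveV _ (denom x) _ _ _ Dn0 dD)).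
  rewrite /f clx -/x !sub0r /GRing.scale/= mulr1 mulrNN.
  by rewrite [_^-1 * x]mulrC mulrA.
- move=> y; rewrite in_itv/= => /andP[y0 y1].
  rewrite /f oppr_lt0; apply: divr_gt0; first exact: mulr_gt0.
  by rewrite exprn_gt0// D0// ltW.
- move=> y; rewrite in_itv/= => /andP[y0 y1].
  apply: cvgN; apply: cvgM; first exact: cvg_cst.
  apply: cvgV; first by rewrite expf_neq0// gt_eqF// D0// ltW.
  apply: (@continuous_comp _ _ _ (denom x) (fun z => z ^+ 2)).
    exact: continuous_denomr.
  exact: exprn_continuous.
- move=> v; rewrite in_itv/= => /andP[v0 vs].
  by apply: cvgM; apply: cd => //; exact: lt_trans su.
- by move=> v _; exact: mulr_ge0.
Qed.

Lemma k_sym (R : realType) (H1 H2 s u : R) : k H1 H2 s u = k H1 H2 u s.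
Proof.
rewrite /k [Num.min s u]minC.
apply: eq_Rintegral => v _.
exact: mulrC.
Qed.

(** [kappa] is not symmetric, but its asymmetric factor [u^(2 H1 - 1)] also occurs in [phi];
    symmetry of [k] therefore reduces the case [u < s] to the other one. *)
Lemma kappaE (R : realType) (H1 H2 s u : R)
    (a := H1 - 1 / 2) (b := H2 - 1 / 2) :
  1 / 2 <= H1 -> H1 < H2 -> H2 < 1 -> 0 < s -> 0 < u -> s != u ->
  kappa H1 H2 s u = (beta_const H2 * (b - a)) ^+ 2 *
    kappa0_integral a b (Num.min s u / Num.max s u) * phi H1 H2 s u.
Proof.
move=> hH1 hH12 hH2 s0 u0 su.
rewrite /kappa /phi.
have -> : 1 - 2 * H1 = - (2 * a) by rewrite /a; field.
have -> : 2 * H2 - 2 * H1 - 1 = 2 * (b - a) - 1 by rewrite /a /b; field.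
have [lt_su|lt_us|eq_su] := ltgtP s u; last by rewrite eq_su eqxx in su.
- rewrite k_integral// -/a -/b distrC gtr0_norm ?subr_gt0//; ring.
- rewrite k_sym k_integral// -/a -/b gtr0_norm ?subr_gt0//; ring.
Qed.

(** * The exceptional null set and the conclusion *)

(** The section of the first axis over 0 is a whole line, so that axis is measured as a rectangle,
    with [0 * +oo = 0]. The rest has section [{0, x}] over every [x], a finite set. *)
Lemma negligible_axes_diagonal (R : realType) :
  (lebesgue_measure \x lebesgue_measure)%E.-negligible
    [set p : R * R | p.1 = 0 \/ p.2 = 0 \/ p.1 = p.2].
Proof.
pose A := [set p : measurableTypeR R * measurableTypeR R | p.1 = 0].
pose B := [set p : measurableTypeR R * measurableTypeR R | p.2 = 0 \/ p.1 = p.2].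
have mA : measurable A.
  have -> : A = setT `&` fst @^-1` [set 0] by rewrite setTI.
  exact: measurable_fst.
have mB : measurable B.
  have -> : B = (setT `&` snd @^-1` [set 0]) `|`
      (setT `&` (fun p => p.1 - p.2) @^-1` [set 0]).
    apply/seteqP; split => -[x y]; rewrite /B /=.
      by move=> [->|->]; [left|right; rewrite subrr].
    by move=> [[_ ->]|[_ /eqP]]; [left|rewrite subr_eq0 => /eqP; right].
  apply: measurableU; first exact: measurable_snd.
  exact: measurable_funB.
rewrite (_ : [set _ | _] = A `|` B)//.
apply: negligibleU.
- exists A; split => //.
  have -> : A = [set 0] `*` setT by apply/seteqP; split => -[x y] /=; tauto.
  apply: eq_trans (product_measure1E _ _ _ _) _ => //.
  apply/eqP; rewrite mule_eq0; apply/orP; left; apply/eqP.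
  exact: lebesgue_measure_set1.
- exists B; split => //; apply: integral0_eq => x _ /=.
  have -> : xsection B x = [set 0] `|` [set x].
    apply/seteqP; split => y; rewrite /xsection /= inE /B/=.
      by move=> [->|->]; [left|right].
    by move=> [->|->]; [left|right].
  apply: countable_lebesgue_measure0.
  by apply: finite_set_countable; rewrite finite_setU; split; exact: finite_set1.
Qed.

Theorem lemma1 (R : realType) (H1 H2 T : R)
    (hH1 : 1 / 2 <= H1) (hH12 : H1 < H2) (hH2 : H2 < 1) (hT : 0 < T) :
  exists kappa0 : R * R -> R,
    [/\ [bounded kappa0 p | p in square T],
        {within square T `\ (0, 0), continuous kappa0} &
        {ae (lebesgue_measure \x lebesgue_measure)%E, forall p : R * R,
          square T p ->
          kappa H1 H2 p.1 p.2 =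
            if p.1 == p.2 then 0
            else kappa0 p * phi H1 H2 p.1 p.2}].
Proof.
pose a := H1 - 1 / 2; pose b := H2 - 1 / 2.
pose C := (beta_const H2 * (b - a)) ^+ 2.
have a0 : 0 <= a by rewrite /a; lra.
have ab : a < b by rewrite /a /b; lra.
have b2 : b < 1 / 2 by rewrite /b; lra.
exists (fun p => C * kappa0_integral a b (Num.min p.1 p.2 / Num.max p.1 p.2)).
split.
(* The bound holds for every real argument, hence also at the origin, where the ratio is [0 / 0 = 0]
   by convention. *)
- have [M hM] := kappa0_integral_bounded a0 ab b2.
  rewrite /bounded_near; near=> N => p _ /=; rewrite normrM.
  apply: le_trans (_ : `|C| * M <= N); first exact: ler_wpM2l.
  by near: N; apply: nbhs_pinfty_ge; rewrite num_real.
- apply: continuous_in_subspaceT => -[s u]; rewrite inE => -[] [/=].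
  rewrite !in_itv/= => /andP[s0 sT] /andP[u0 uT] su0.
  (* Away from the origin the larger coordinate is positive, so the ratio is continuous. *)
  have max_gt0 : Num.max s u != 0.
    rewrite gt_eqF// lt_max.
    have [//|s_le0] := ltP 0 s; have [//|u_le0] := ltP 0 u.
    by case: su0; congr (_, _); apply: le_anti; apply/andP.
  apply: cvgM; first exact: cvg_cst.
  apply: (@continuous_comp _ _ _ (fun p : R * R => Num.min p.1 p.2 / Num.max p.1 p.2)
    (kappa0_integral a b)); last exact: continuous_kappa0_integral.
  apply: cvgM; first exact: min_continuous.
  by apply: cvgV => //; exact: max_continuous.
(* By contraposition: a point of the square off both axes and the diagonal has distinct positive
   coordinates, so [kappaE] applies. *)
- apply: negligibleS (negligible_axes_diagonal R) => -[s u] /=.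
  apply: contra_notP => /not_orP[s0 /not_orP[u0 su]].
  move=> [/=]; rewrite !in_itv/= => /andP[s_ge0 _] /andP[u_ge0 _].
  rewrite (negbTE (introN eqP su)) kappaE//.
  + by rewrite lt_neqAle s_ge0 andbT eq_sym; exact/eqP.
  + by rewrite lt_neqAle u_ge0 andbT eq_sym; exact/eqP.
  + exact/eqP.
Unshelve. all: by end_near. Qed.
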